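(* Let $r,s,t\in\mathbb{R}$ with $r\cdot s\cdot t\neq 0$ and $\frac1t=\frac1r+\frac1s$. Then for every positive integer $n$ and all vectors $\vec{v}=(v_1,\ldots,v_n),\ \vec{x}=(x_1,\ldots,x_n)\in\mathbb{C}^n$, writing $\vec{v}\cdot\vec{x}=(v_1x_1,\ldots,v_nx_n)$ for the componentwise product: (i) if $t<r$ and $t<s$, then $\|\vec{v}\cdot\vec{x}\|_t\le\|\vec{v}\|_r\cdot\|\vec{x}\|_s$; (ii) if $t>r$ and $t>s$, then $\|\vec{v}\cdot\vec{x}\|_t\ge\|\vec{v}\|_r\cdot\|\vec{x}\|_s$.
   Context: Hölder weights on $\mathbb{C}^n$: for $\vec{x}=(x_1,\ldots,x_n)\in\mathbb{C}^n$, - for $p\in(0,\infty)$: $\|\vec{x}\|_p := \left(\sum_{i=1}^n |x_i|^p\right)^{1/p}$; - for $p\in(-\infty,0)$: $\|\vec{x}\|_p := \left(\sum_{i=1}^n |x_i|^p\right)^{1/p}$ if $\prod_{i=1}^n x_i\neq 0$, and $\|\vec{x}\|_p := 0$ if $\prod_{i=1}^n x_i=0$. *)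

(* Defs.v *)
From HB Require Import structures.
From mathcomp Require Import all_boot all_order all_algebra.
From mathcomp Require Import reals exp complex.

Set Implicit Arguments.
Unset Strict Implicit.
Unset Printing Implicit Defensive.

Import Order.TTheory GRing.Theory Num.Theory.

Local Open Scope ring_scope.
Local Open Scope complex_scope.

(* C is R[i]. The modulus is the R-valued [normc], since the library norm on
   R[i] takes its values in R[i]. As [powR 0 p = 0] also for p < 0, vectors with
   a zero entry need the separate branch there. The value at p = 0 is junk. *)
Definition holder_weight (R : realType) (n : nat) (p : R) (x : 'rV[R[i]]_n)
    : R :=
  if (p < 0) && (\prod_(i < n) x ord0 i == 0) then 0
  else powR (\sum_(i < n) powR (ComplexField.Normc.normc (x ord0 i)) p) p^-1.

Definition cwmul (R : realType) (n : nat) (v x : 'rV[R[i]]_n) : 'rV[R[i]]_n :=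
  \row_(i < n) (v ord0 i * x ord0 i).

(* Main.v *)
(* Hölder's inequality for positive exponents comes from summing Young's
   inequality over the normalised entries. All other sign patterns of the
   exponents reduce to it: inverting every entry exchanges the exponents [p] and
   [- p] and inverts the weight, so moving terms across [1/t = 1/r + 1/s] until
   all exponents are positive turns the claim into Hölder's inequality for
   [a b] and [a^-1], for [(a b)^-1] and [a], or for [a^-1] and [b^-1]. Zero
   entries only make trivial whichever side must be small. *)
Require Import Defs.
From mathcomp Require Import all_boot all_order all_algebra.
From mathcomp Require Import reals exp complex.
From mathcomp Require Import lra.

Import Order.TTheory GRing.Theory Num.Theory.

Local Open Scope ring_scope.
Local Open Scope complex_scope.

(** * Power-sum weights of real vectors *)

Definition psum (R : realType) (n : nat) (p : R) (a : 'I_n -> R) : R :=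
  \sum_(i < n) powR (a i) p.
Arguments psum {R n} p a.

(** There is no branch for zero entries, so for [p < 0] it may differ from the Hölder weight when
    some entry is [0]. *)
Definition pnorm (R : realType) (n : nat) (p : R) (a : 'I_n -> R) : R :=
  powR (psum p a) p^-1.
Arguments pnorm {R n} p a.

Section RealWeights.
Context {R : realType} {n : nat}.
Implicit Types (p r s t : R) (a b : 'I_n -> R).

Lemma psum_ge0 p a : 0 <= psum p a.
Proof. by apply: sumr_ge0 => i _; exact: powR_ge0. Qed.

Lemma pnorm_ge0 p a : 0 <= pnorm p a.
Proof. exact: powR_ge0. Qed.

Lemma eq_pnorm p a b : a =1 b -> pnorm p a = pnorm p b.
Proof.
by move=> ab; congr (powR _ _); apply: eq_bigr => i _; rewrite ab.
Qed.

(** Permits division by weights after entries are inverted; an empty vector would have power sum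
    [0]. *)
Lemma pnorm_gt0 p a : (0 < n)%N -> (forall i, 0 < a i) -> 0 < pnorm p a.
Proof.
move=> n_gt0 a_gt0; apply: powR_gt0.
rewrite /psum (bigD1 (Ordinal n_gt0)) //= ltr_wpDr ?powR_gt0 //.
by apply: sumr_ge0 => i _; exact: powR_ge0.
Qed.

(** Termwise [(a i)^-1] to the power [- p] is [a i] to the power [p], so only the outer exponent
    changes sign. Zero entries are covered, as [0^-1 = 0] and [powR 0 (- p) = powR 0 p]. *)
Lemma pnormV p a : (forall i, 0 <= a i) ->
  pnorm (- p) (fun i => (a i)^-1) = (pnorm p a)^-1.
Proof.
move=> a_ge0; rewrite /pnorm invrN powRN; congr (powR _ _)^-1.
apply: eq_bigr => i _.
by rewrite -powR_inv1 // -powRrM mulrNN mul1r.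
Qed.

Lemma psum_eq0 p a : p != 0 -> psum p a = 0 -> forall i, a i = 0.
Proof.
move=> p_neq0 /eqP; rewrite psumr_eq0; last by move=> i _; exact: powR_ge0.
by move=> /allP/= a0 i; have /eqP/powR_eq0_eq0 := a0 i (mem_index_enum i).
Qed.

Lemma powR_pnorm p a : p != 0 -> powR (pnorm p a) p = psum p a.
Proof. by move=> p_neq0; rewrite -powRrM mulVf // powRr1 // psum_ge0. Qed.

Lemma pnorm_eq0 p a : p != 0 -> pnorm p a = 0 -> forall i, a i = 0.
Proof. by move=> p_neq0 /powR_eq0_eq0; exact: psum_eq0. Qed.

Lemma pnorm0 p : 0 < p -> pnorm p (fun _ : 'I_n => 0) = 0.
Proof.
by move=> p_gt0; rewrite /pnorm /psum big1 ?powR0 ?invr_eq0 ?gt_eqF.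
Qed.

(** Young's inequality for [powR c t] and [powR d t] with exponents [r / t] and [s / t], conjugate
    because [t / r + t / s = t * t^-1 = 1]. *)
Lemma young_powR r s t (c d : R) : 0 < r -> 0 < s -> 0 < t ->
  t^-1 = r^-1 + s^-1 -> 0 <= c -> 0 <= d ->
  powR (c * d) t <= t / r * powR c r + t / s * powR d s.
Proof.
move=> r_gt0 s_gt0 t_gt0 trs c_ge0 d_ge0.
have t_neq0 : t != 0 by rewrite gt_eqF.
rewrite powRM //.
have := @conjugate_powR R (powR c t) (powR d t) (r / t) (s / t)
  (powR_ge0 _ _) (powR_ge0 _ _) (divr_gt0 r_gt0 t_gt0) (divr_gt0 s_gt0 t_gt0).
rewrite !invf_div -mulrDr -trs divff // => /(_ erefl).
rewrite -!powRrM !(mulrC t) !divfK //.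
by rewrite [powR c r * _]mulrC [powR d s * _]mulrC.
Qed.

Lemma holder_pnorm r s t a b : 0 < r -> 0 < s -> 0 < t ->
  t^-1 = r^-1 + s^-1 -> (forall i, 0 <= a i) -> (forall i, 0 <= b i) ->
  pnorm t (fun i => a i * b i) <= pnorm r a * pnorm s b.
Proof.
move=> r_gt0 s_gt0 t_gt0 trs a_ge0 b_ge0.
have [r_neq0 s_neq0 t_neq0] : [/\ r != 0, s != 0 & t != 0] by rewrite !gt_eqF.
(* A vector of weight [0] is zero, and then so is the product; otherwise both vectors can be
   normalised. *)
have [A0|A_neq0] := eqVneq (pnorm r a) 0.
  rewrite (eq_pnorm t _ (fun=> 0)) ?pnorm0 ?mulr_ge0 ?pnorm_ge0 // => i.
  by rewrite (pnorm_eq0 r a r_neq0 A0) mul0r.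
have [B0|B_neq0] := eqVneq (pnorm s b) 0.
  rewrite (eq_pnorm t _ (fun=> 0)) ?pnorm0 ?mulr_ge0 ?pnorm_ge0 // => i.
  by rewrite (pnorm_eq0 s b s_neq0 B0) mulr0.
have psum_normalised p c : p != 0 -> (forall i, 0 <= c i) -> pnorm p c != 0 ->
    \sum_(i < n) powR (c i / pnorm p c) p = 1.
  move=> p_neq0 c_ge0 c_neq0; under eq_bigr => i _.
    rewrite powRM ?invr_ge0 ?pnorm_ge0 // -(powR_inv1 (pnorm_ge0 _ _)).
    rewrite -powRrM mulN1r powRN powR_pnorm //; over.
  rewrite -mulr_suml divff //; apply: contraNneq c_neq0.
  by rewrite /pnorm /psum => ->; rewrite powR0 // invr_eq0.
have := psum_normalised r a r_neq0 a_ge0 A_neq0.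
have := psum_normalised s b s_neq0 b_ge0 B_neq0.
have := pnorm_ge0 r a; have := pnorm_ge0 s b.
move: (pnorm r a) (pnorm s b) A_neq0 B_neq0 => A B A_neq0 B_neq0.
move=> B_ge0 A_ge0 sumB sumA.
(* Raising to the power [t^-1 > 0] is monotone, so power sums can be compared; by homogeneity the
   factor [powR (A * B) t] then splits off. *)
suff le_t : psum t (fun i => a i * b i) <= powR (A * B) t.
  apply: le_trans (_ : powR (powR (A * B) t) t^-1 <= _).
    by rewrite ge0_ler_powR ?invr_ge0 ?(ltW t_gt0) // ?nnegrE ?psum_ge0 ?powR_ge0.
  by rewrite -powRrM divff // powRr1 // mulr_ge0.
have -> : psum t (fun i => a i * b i) =
    powR (A * B) t * \sum_(i < n) powR (a i / A * (b i / B)) t.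
  rewrite mulr_sumr; apply: eq_bigr => i _.
  rewrite -powRM ?mulr_ge0 ?invr_ge0 //.
  by rewrite mulrACA (mulrC A) (mulrC B) !divfK.
rewrite ler_piMr ?powR_ge0 //.
(* Since both normalised power sums are [1], the sum of the Young bounds is [t / r + t / s = 1]. *)
apply: (@le_trans _ _ (\sum_(i < n)
    (t / r * powR (a i / A) r + t / s * powR (b i / B) s))).
  by apply: ler_sum => i _; apply: young_powR; rewrite ?divr_ge0.
by rewrite big_split -!mulr_sumr /= sumA sumB !mulr1 -mulrDr -trs divff.
Qed.

(** Hölder at exponents [- t] and [r] for [(a b)^-1] and [a], whose product [b^-1] gets exponent
    [- s]; this reads [S^-1 <= T^-1 * A]. *)
Lemma holder_pnorm_neg_mixed r s t a b : (0 < n)%N ->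
  0 < r -> s < 0 -> t < 0 -> t^-1 = r^-1 + s^-1 ->
  (forall i, 0 < a i) -> (forall i, 0 < b i) ->
  pnorm t (fun i => a i * b i) <= pnorm r a * pnorm s b.
Proof.
move=> n_gt0 r_gt0 s_lt0 t_lt0 trs a_gt0 b_gt0.
have ab_gt0 i : 0 < a i * b i by rewrite mulr_gt0.
have abV_ge0 i : 0 <= (a i * b i)^-1 by rewrite invr_ge0 ltW.
have := holder_pnorm (- t) r (- s) _ _ _ r_gt0 _ _ abV_ge0 (fun i => ltW (a_gt0 i)).
rewrite !oppr_gt0 !invrN trs opprD addrAC addNr add0r => /(_ t_lt0 s_lt0 erefl).
rewrite (eq_pnorm _ _ (fun i => (b i)^-1)); last first.
  by move=> i; rewrite invfM mulrAC mulVf ?mul1r // gt_eqF.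
rewrite !pnormV => [|i|i]; [|exact: ltW|exact: ltW].
move: (pnorm_gt0 s b n_gt0 b_gt0) (pnorm_gt0 t _ n_gt0 ab_gt0).
move: (pnorm s b) (pnorm t _) (pnorm r a) => S T A S_gt0 T_gt0.
by rewrite [_^-1 * _]mulrC ler_pdivlMr // mulrC ler_pdivrMr.
Qed.

(** Hölder for [a^-1] and [b^-1] at the negated exponents reads [T^-1 <= A^-1 * S^-1]. *)
Lemma rev_holder_pnorm_neg r s t a b : (0 < n)%N ->
  r < 0 -> s < 0 -> t < 0 -> t^-1 = r^-1 + s^-1 ->
  (forall i, 0 < a i) -> (forall i, 0 < b i) ->
  pnorm r a * pnorm s b <= pnorm t (fun i => a i * b i).
Proof.
move=> n_gt0 r_lt0 s_lt0 t_lt0 trs a_gt0 b_gt0.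
have ab_gt0 i : 0 < a i * b i by rewrite mulr_gt0.
have aV_ge0 i : 0 <= (a i)^-1 by rewrite invr_ge0 ltW.
have bV_ge0 i : 0 <= (b i)^-1 by rewrite invr_ge0 ltW.
have := holder_pnorm (- r) (- s) (- t) _ _ _ _ _ _ aV_ge0 bV_ge0.
rewrite !oppr_gt0 !invrN trs opprD => /(_ r_lt0 s_lt0 t_lt0 erefl).
rewrite (eq_pnorm _ _ (fun i => (a i * b i)^-1)); last by move=> i; rewrite invfM.
rewrite !pnormV => [|i|i|i]; do ?exact: ltW.
move: (pnorm_gt0 r a n_gt0 a_gt0) (pnorm_gt0 s b n_gt0 b_gt0).
move: (pnorm_gt0 t _ n_gt0 ab_gt0).
move: (pnorm s b) (pnorm t _) (pnorm r a) => S T A T_gt0 A_gt0 S_gt0.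
by rewrite -invfM lef_pV2 // posrE mulr_gt0.
Qed.

(** Hölder at exponents [t] and [- r] for [a b] and [a^-1], with product [b] at exponent [s], reads
    [S <= T * A^-1]. Only [a] is inverted, so [b] may have zeros. *)
Lemma rev_holder_pnorm_mixed r s t a b : (0 < n)%N ->
  r < 0 -> 0 < s -> 0 < t -> t^-1 = r^-1 + s^-1 ->
  (forall i, 0 < a i) -> (forall i, 0 <= b i) ->
  pnorm r a * pnorm s b <= pnorm t (fun i => a i * b i).
Proof.
move=> n_gt0 r_lt0 s_gt0 t_gt0 trs a_gt0 b_ge0.
have ab_ge0 i : 0 <= a i * b i by rewrite mulr_ge0 // ltW.
have aV_ge0 i : 0 <= (a i)^-1 by rewrite invr_ge0 ltW.
have := holder_pnorm t (- r) s _ _ t_gt0 _ s_gt0 _ ab_ge0 aV_ge0.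
rewrite oppr_gt0 invrN trs addrAC subrr add0r => /(_ r_lt0 erefl).
rewrite (eq_pnorm s _ b); last first.
  by move=> i; rewrite mulrAC divff ?mul1r // gt_eqF.
rewrite pnormV => [|i]; last exact: ltW.
move: (pnorm_gt0 r a n_gt0 a_gt0).
move: (pnorm s b) (pnorm t _) (pnorm r a) => S T A A_gt0.
by rewrite ler_pdivlMr // mulrC.
Qed.

End RealWeights.

(** * Complex vectors and zero entries *)

Section ComplexWeights.
Context {R : realType} {n : nat}.
Implicit Types (p r s t : R) (v x : 'rV[R[i]]_n).

Local Notation normc := ComplexField.Normc.normc.

Lemma normc_ge0 (z : R[i]) : 0 <= normc z.
Proof. by case: z => u w; exact: sqrtr_ge0. Qed.

Lemma normc_gt0 (z : R[i]) : z != 0 -> 0 < normc z.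
Proof.
move=> z_neq0; rewrite lt_def normc_ge0 andbT.
by apply: contraNneq z_neq0 => /ComplexField.Normc.eq0_normc ->.
Qed.

Lemma holder_weight_ge0 p x : 0 <= holder_weight p x.
Proof. by rewrite /holder_weight; case: ifP => // _; exact: powR_ge0. Qed.

Lemma holder_weight_pos p x : 0 < p ->
  holder_weight p x = pnorm p (fun i => normc (x ord0 i)).
Proof. by move=> p_gt0; rewrite /holder_weight ltNge ltW. Qed.

Lemma holder_weight_neq0 p x : (forall i, x ord0 i != 0) ->
  holder_weight p x = pnorm p (fun i => normc (x ord0 i)).
Proof.
move=> x_neq0; rewrite /holder_weight ifN // negb_and; apply/orP; right.
by apply/prodf_neq0 => i _.
Qed.

Lemma holder_weight_eq0 p x i : p < 0 -> x ord0 i = 0 -> holder_weight p x = 0.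
Proof.
by move=> p_lt0 xi0; rewrite /holder_weight p_lt0 (bigD1 i) //= xi0 mul0r eqxx.
Qed.

Lemma has_zero_entry x : (forall i, x ord0 i != 0) \/ exists i, x ord0 i = 0.
Proof.
case: (boolP [forall i, x ord0 i != 0]) => [/forallP|]; first by left.
by rewrite negb_forall => /existsP; case=> i; rewrite negbK => /eqP; right; exists i.
Qed.

Lemma cwmulC v x : cwmul v x = cwmul x v.
Proof. by apply/rowP => i; rewrite !mxE mulrC. Qed.

Lemma pnorm_cwmul p v x : pnorm p (fun i => normc (cwmul v x ord0 i)) =
  pnorm p (fun i => normc (v ord0 i) * normc (x ord0 i)).
Proof. by apply: eq_pnorm => i; rewrite mxE ComplexField.Normc.normcM. Qed.

Lemma cwmul_neq0 v x : (forall i, v ord0 i != 0) -> (forall i, x ord0 i != 0) ->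
  forall i, cwmul v x ord0 i != 0.
Proof. by move=> v_neq0 x_neq0 i; rewrite mxE mulf_neq0. Qed.

Lemma holder_weight_mul_mixed r s t v x : (0 < n)%N ->
  0 < r -> s < 0 -> t < 0 -> t^-1 = r^-1 + s^-1 ->
  holder_weight t (cwmul v x) <= holder_weight r v * holder_weight s x.
Proof.
move=> n_gt0 r_gt0 s_lt0 t_lt0 trs.
(* A zero in either factor is a zero of the product, whose weight is then [0] because [t < 0]. *)
have [v_neq0|[i vi0]] := has_zero_entry v; last first.
  by rewrite (holder_weight_eq0 t _ i) ?mulr_ge0 ?holder_weight_ge0 // mxE vi0 mul0r.
have [x_neq0|[i xi0]] := has_zero_entry x; last first.
  by rewrite (holder_weight_eq0 t _ i) ?mulr_ge0 ?holder_weight_ge0 // mxE xi0 mulr0.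
rewrite !holder_weight_neq0 ?pnorm_cwmul //; last exact: cwmul_neq0.
by apply: holder_pnorm_neg_mixed => // i; exact: normc_gt0.
Qed.

Lemma rev_holder_weight_mul_mixed r s t v x : (0 < n)%N ->
  r < 0 -> 0 < s -> 0 < t -> t^-1 = r^-1 + s^-1 ->
  holder_weight r v * holder_weight s x <= holder_weight t (cwmul v x).
Proof.
move=> n_gt0 r_lt0 s_gt0 t_gt0 trs.
(* A zero of [v] makes the smaller side [0] because [r < 0]; zeros of [x] are harmless at the
   positive exponents [s] and [t]. *)
have [v_neq0|[i vi0]] := has_zero_entry v; last first.
  by rewrite (holder_weight_eq0 r _ i) // mul0r holder_weight_ge0.
rewrite (holder_weight_neq0 r) // !holder_weight_pos // pnorm_cwmul.
by apply: rev_holder_pnorm_mixed => // i; [exact: normc_gt0|exact: normc_ge0].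
Qed.

Lemma rev_holder_weight_mul_neg r s t v x : (0 < n)%N ->
  r < 0 -> s < 0 -> t < 0 -> t^-1 = r^-1 + s^-1 ->
  holder_weight r v * holder_weight s x <= holder_weight t (cwmul v x).
Proof.
move=> n_gt0 r_lt0 s_lt0 t_lt0 trs.
have [v_neq0|[i vi0]] := has_zero_entry v; last first.
  by rewrite (holder_weight_eq0 r _ i) // mul0r holder_weight_ge0.
have [x_neq0|[i xi0]] := has_zero_entry x; last first.
  by rewrite (holder_weight_eq0 s _ i) // mulr0 holder_weight_ge0.
rewrite !holder_weight_neq0 ?pnorm_cwmul //; last exact: cwmul_neq0.
by apply: rev_holder_pnorm_neg => // i; exact: normc_gt0.
Qed.

End ComplexWeights.

(** * Case analysis on the signs of the exponents *)

Theorem theorem2 (R : realType) (r s t : R) (hrst : r * s * t != 0)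
    (ht : t^-1 = r^-1 + s^-1) (n : nat) (hn : (0 < n)%N)
    (v x : 'rV[R[i]]_n) :
  (t < r -> t < s ->
     holder_weight t (cwmul v x) <= holder_weight r v * holder_weight s x) /\
  (r < t -> s < t ->
     holder_weight r v * holder_weight s x <= holder_weight t (cwmul v x)).
Proof.
(* Serves the cases in which [cwmulC] exchanges the roles of [v] and [x]. *)
have ht' : t^-1 = s^-1 + r^-1 by rewrite addrC.
move: hrst; rewrite !mulf_eq0 !negb_or => /andP[/andP[r_neq0 s_neq0] t_neq0].
split=> t_r t_s.
- have [t_lt0|t_gt0|/eqP] := ltgtP t 0; last by rewrite (negbTE t_neq0).
    have [r_lt0|r_gt0|/eqP] := ltgtP r 0; last by rewrite (negbTE r_neq0).
      have [s_lt0|s_gt0|/eqP] := ltgtP s 0; last by rewrite (negbTE s_neq0).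
        (* Three negative exponents are impossible here: [r^-1 = t^-1 - s^-1] would be positive. *)
        have st : s^-1 < t^-1 by rewrite ltf_nV2 // negrE.
        by exfalso; move: r_lt0; rewrite -invr_lt0; lra.
      by rewrite cwmulC mulrC; exact: holder_weight_mul_mixed.
    have [s_lt0|s_gt0|/eqP] := ltgtP s 0; last by rewrite (negbTE s_neq0).
      exact: holder_weight_mul_mixed.
    exfalso; move: t_lt0 r_gt0 s_gt0.
    by rewrite -invr_lt0 -(invr_gt0 r) -(invr_gt0 s); lra.
  have r_gt0 := lt_trans t_gt0 t_r; have s_gt0 := lt_trans t_gt0 t_s.
  rewrite !holder_weight_pos // pnorm_cwmul.
  by apply: holder_pnorm => // i; exact: normc_ge0.
- have [t_lt0|t_gt0|/eqP] := ltgtP t 0; last by rewrite (negbTE t_neq0).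
    have r_lt0 := lt_trans t_r t_lt0; have s_lt0 := lt_trans t_s t_lt0.
    exact: rev_holder_weight_mul_neg.
  have [r_lt0|r_gt0|/eqP] := ltgtP r 0; last by rewrite (negbTE r_neq0).
    have [s_lt0|s_gt0|/eqP] := ltgtP s 0; last by rewrite (negbTE s_neq0).
      exfalso; move: t_gt0 r_lt0 s_lt0.
      by rewrite -invr_gt0 -(invr_lt0 r) -(invr_lt0 s); lra.
    exact: rev_holder_weight_mul_mixed.
  have [s_lt0|s_gt0|/eqP] := ltgtP s 0; last by rewrite (negbTE s_neq0).
    by rewrite cwmulC mulrC; exact: rev_holder_weight_mul_mixed.
  (* Three positive exponents are impossible here: [s^-1 = t^-1 - r^-1] would be negative. *)
  have tr : t^-1 < r^-1 by rewrite ltf_pV2 // posrE.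
  by exfalso; move: s_gt0; rewrite -invr_gt0; lra.
Qed.
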